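(* Let $r\ge 1$ and let $0<s_1<s_2<\cdots<s_{r-1}<s_r=1$ be real numbers such that $s_{j+1}\leq s_j+s_1$ for all $j$ with $1\leq j<r$. Then the Nim value function $g:\mathbb{R}_{\ge 0}\to\mathbb{Z}_{\ge 0}$ of $G(\{s_1,s_2,\ldots,s_r\})$ is given by $$g(x)=\left\lfloor \frac{x\bmod (1+s_1)}{s_1}\right\rfloor\qquad (x\ge 0).$$ In particular, $g$ is purely periodic with minimum period $1+s_1$.
   Context: For a nonempty finite set $S\subset\mathbb{R}_{>0}$, the Continim $G(S)$ is the impartial game (normal play) whose positions are the real numbers $x\ge 0$ and whose moves are $x\mapsto x-s$ with $s\in S$, $s\le x$. Its Nim value function $g_S:\mathbb{R}_{\ge0}\to\mathbb{Z}_{\ge0}$ is the Sprague–Grundy function, $g_S(x)=\operatorname{mex}\{g_S(x-s)\mid s\in S,\ s\le x\}$, where $\operatorname{mex}A$ is the least nonnegative integer not in $A$. For $b\in\mathbb{R}$ and $a\in\mathbb{R}_{>0}$, $b\bmod a=b-\lfloor b/a\rfloor a$. A function $f:\mathbb{R}_{\ge0}\to\mathbb{Z}_{\ge0}$ is periodic with period $p>0$ and preperiod $x_0\ge 0$ if $f(x+p)=f(x)$ for all $x\ge x_0$. The minimum period is the smallest $p>0$ that is a period (for some preperiod). $f$ is purely periodic if its minimum preperiod is $0$, i.e. $f(x+p)=f(x)$ for all $x\ge0$ for some period $p>0$. *)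

(* Defs.v *)
From HB Require Import structures.
From mathcomp Require Import all_boot all_order all_algebra finmap.
From mathcomp Require Import reals.

Set Implicit Arguments.
Unset Strict Implicit.
Unset Printing Implicit Defensive.

Import Order.TTheory GRing.Theory Num.Theory.
Local Open Scope ring_scope.

Lemma mex_exists (A : seq nat) : exists n, n \notin A.
Proof.
exists (\max_(a <- A) a).+1; apply/negP => An.
by have := @leq_bigmax_seq _ A xpredT id _ An isT; rewrite ltnn.
Qed.

Definition mex (A : seq nat) : nat := ex_minn (mex_exists A).

Definition moves (R : realType) (S : {fset R}) (x : R) : seq R :=
  [seq x - s | s <- S & s <= x].

(* Evaluation of the recursion g x = mex {g y | y a move from x} to depth n. *)
Fixpoint nim_rec (R : realType) (S : {fset R}) (n : nat) (x : R) : nat :=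
  if n is n'.+1 then mex [seq nim_rec S n' y | y <- moves S x] else 0%N.

(* A bound on the length of a play from x: each move x |-> x - t with t \in S
   lowers the term x / t of the sum by 1, and no term increases. *)
Definition play_bound (R : realType) (S : {fset R}) (x : R) : R :=
  \sum_(s <- S) x / s.

(* The Sprague-Grundy function of G(S), meaningful for S included in ]0, +oo[
   and x >= 0; see nim_valueE and nim_value_uniq. *)
Definition nim_value (R : realType) (S : {fset R}) (x : R) : nat :=
  nim_rec S (Num.truncn (play_bound S x)).+1 x.

Lemma moves_ge0 (R : realType) (S : {fset R}) (x y : R) :
  y \in moves S x -> 0 <= y.
Proof.
by move=> /mapP[s]; rewrite mem_filter => /andP[sx _] ->; rewrite subr_ge0.
Qed.

Section Recursion.
Variables (R : realType) (S : {fset R}).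
Hypothesis S_gt0 : forall s, s \in S -> 0 < s.

Lemma play_bound_ge0 x : 0 <= x -> 0 <= play_bound S x.
Proof.
move=> x0; rewrite /play_bound big_seq; apply: sumr_ge0 => s sS.
by rewrite divr_ge0 // ltW // S_gt0.
Qed.

Lemma play_bound_move x y : y \in moves S x ->
  play_bound S y + 1 <= play_bound S x.
Proof.
move=> /mapP[t]; rewrite mem_filter => /andP[tx tS] ->.
have -> : play_bound S (x - t) = play_bound S x - play_bound S t.
  by rewrite /play_bound -sumrB; apply: eq_bigr => s _; rewrite mulrBl.
rewrite -addrA gerDl addrC subr_le0 /play_bound (big_rem t) //=.
rewrite divff ?gt_eqF ?S_gt0 // lerDl big_seq sumr_ge0 // => s /mem_rem sS.
by rewrite divr_ge0 // ltW // S_gt0.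
Qed.

Lemma nim_rec_depth n m x : 0 <= x ->
  play_bound S x < n%:R -> play_bound S x < m%:R -> nim_rec S n x = nim_rec S m x.
Proof.
elim: n m x => [|n IH] [|m] x x0; rewrite ?ltNge ?play_bound_ge0 //.
rewrite -!ltNge -!natr1 => xn xm /=; congr mex; apply/eq_in_map => y yx.
have := play_bound_move yx => le.
apply: IH; first exact: moves_ge0 yx.
- by rewrite -(ltrD2r 1) (le_lt_trans le).
- by rewrite -(ltrD2r 1) (le_lt_trans le).
Qed.

Lemma nim_valueE x : 0 <= x ->
  nim_value S x = mex [seq nim_value S y | y <- moves S x].
Proof.
move=> x0; rewrite [LHS]/=; congr mex; apply/eq_in_map => y yx.
have y0 := moves_ge0 yx; have le := play_bound_move yx.
apply: nim_rec_depth => //.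
  rewrite -(ltrD2r 1) (le_lt_trans le) // natr1.
  by have /andP[] := truncn_itv (play_bound_ge0 x0).
by have /andP[] := truncn_itv (play_bound_ge0 y0).
Qed.

Lemma nim_value_uniq (g : R -> nat) :
  (forall x, 0 <= x -> g x = mex [seq g y | y <- moves S x]) ->
  forall x, 0 <= x -> g x = nim_value S x.
Proof.
move=> gE x x0; rewrite /nim_value.
have : play_bound S x < (Num.truncn (play_bound S x)).+1%:R.
  by have /andP[] := truncn_itv (play_bound_ge0 x0).
move: (Num.truncn _).+1 => n; elim: n x x0 => [|n IH] x x0; first by rewrite ltNge play_bound_ge0.
rewrite -natr1 => xn /=; rewrite gE //; congr mex; apply/eq_in_map => y yx.
apply: IH; first exact: moves_ge0 yx.
by rewrite -(ltrD2r 1) (le_lt_trans (play_bound_move yx)).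
Qed.

End Recursion.

Definition rmod (R : realType) (b a : R) : R := b - (Num.floor (b / a))%:~R * a.

(* Functions on [0, +oo[ are represented by functions on R of which only the
   values at nonnegative arguments matter. *)
Definition period_from (R : realType) (f : R -> nat) (p x0 : R) : Prop :=
  [/\ 0 < p, 0 <= x0 & forall x, x0 <= x -> f (x + p) = f x].

Definition is_period (R : realType) (f : R -> nat) (p : R) : Prop :=
  exists x0, period_from f p x0.

Definition minimum_period (R : realType) (f : R -> nat) (p : R) : Prop :=
  is_period f p /\ forall q, is_period f q -> p <= q.

Definition purely_periodic (R : realType) (f : R -> nat) : Prop :=
  exists p, period_from f p 0.

(* Main.v *)
Require Import Defs.
From mathcomp Require Import all_boot all_order all_algebra finmap.
From mathcomp Require Import reals.
From mathcomp Require Import lra.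
Set Implicit Arguments.
Unset Strict Implicit.
Unset Printing Implicit Defensive.

Import Order.TTheory GRing.Theory Num.Theory.
Local Open Scope ring_scope.

(** Write [a] for the least and [b] for the greatest element of the set
    [S] of moves ([b = 1] in the theorem), and [t] for the residue
    of [x] modulo [b + a].  The function [floor (t / a)] cuts a period
    into consecutive blocks of length [a] (the last one possibly shorter) and numbers them from 0; since the mex
    recursion determines the Nim value, it suffices to see that this block
    number satisfies the recursion.

    - No move stays in the block numbered [n].  A move by [c] with [c <= t]
      lowers the residue by at least [a], hence lowers the block number; a
      move with [c > t] wraps around and turns the residue into
      [t + a + (b - c)], which raises the block number.
    - Every block [m < n] is reached: this needs some [c] in [S] in the window
      [t - (m + 1) a < c <= t - m a], which has length [a].  Windows of that
      length catch an element of [S] as soon as their right end lies in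
      [a, b + a[, because consecutive elements of [S] are at most [a]
      apart ([chain_meets_window]).

    This is [nim_value_block], stated for any finite set included in [a, b]
    that meets all these windows.  For the minimum period only blocks 0 and 1
    matter: a period shorter than [b + a] would have to be shorter than
    block 0, and would then carry a point of block 0 to the beginning of
    block 1 ([minimum_period_block]). *)

Lemma mexP (A : seq nat) (n : nat) :
  n \notin A -> (forall m, (m < n)%N -> m \in A) -> mex A = n.
Proof.
move=> nA ltA; rewrite /mex; case: ex_minnP => m mA mle.
apply/eqP; rewrite eqn_leq mle //= leqNgt; apply/negP => /ltA.
by rewrite (negbTE mA).
Qed.

Section Residue.
Variables (R : realType) (p : R).
Hypothesis p_gt0 : 0 < p.

Lemma rmod_itv (x : R) : 0 <= rmod x p < p.
Proof.
rewrite /rmod subr_ge0 -ler_pdivlMr // floor_le /= ltrBlDl.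
rewrite -[X in _ < _ + X]mul1r -mulrDl -ltr_pdivrMr //.
by have := floorD1_gt (x / p); rewrite intrD.
Qed.

Lemma rmod_eq (k : int) (t : R) : 0 <= t < p -> rmod (k%:~R * p + t) p = t.
Proof.
move=> /andP[t0 tp]; rewrite /rmod.
suff -> : Num.floor ((k%:~R * p + t) / p) = k by rewrite addrC addKr.
apply: floor_def; rewrite ler_pdivlMr // ltr_pdivrMr // intrD mulrDl mul1r.
by rewrite lerDl t0 ltrD2l.
Qed.

End Residue.

(** The absolute value only turns the floor, which is nonnegative for positive
    [p] and [a], into a natural number. *)
Definition block (R : realType) (p a x : R) : nat :=
  `|Num.floor (rmod x p / a)|%N.

Section Block.
Variables (R : realType) (p a : R).
Hypotheses (p_gt0 : 0 < p) (a_gt0 : 0 < a).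

Lemma blockE (x : R) : (block p a x)%:Z = Num.floor (rmod x p / a).
Proof.
rewrite /block gez0_abs // floor_ge0 divr_ge0 ?(ltW a_gt0) //.
by have /andP[] := rmod_itv p_gt0 x.
Qed.

Lemma block_eq (k : int) (t : R) (n : nat) : 0 <= t < p ->
  (block p a (k%:~R * p + t) == n) = (n%:R * a <= t < n.+1%:R * a).
Proof.
move=> t_itv; rewrite -eqz_nat blockE rmod_eq // floor_eq.
by rewrite ler_pdivlMr // ltr_pdivrMr // intrD -pmulrn natr1.
Qed.

Lemma block_itv (x : R) :
  (block p a x)%:R * a <= rmod x p < (block p a x).+1%:R * a.
Proof.
rewrite -(block_eq (Num.floor (x / p))) ?rmod_itv //.
by rewrite /rmod addrC subrK.
Qed.

Lemma block_period (x : R) : block p a (x + p) = block p a x.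
Proof.
apply/eqP; have xE : x = (Num.floor (x / p))%:~R * p + rmod x p.
  by rewrite /rmod addrC subrK.
have -> : x + p = (Num.floor (x / p) + 1)%:~R * p + rmod x p.
  by rewrite {1}xE intrD mulrDl mul1r addrAC.
by rewrite block_eq ?rmod_itv // block_itv.
Qed.

(** A period [q < p] would carry the start of a period, where the value is 0,
    to another point of value 0, so that [q < a].  Then [a - q] is in block 0
    while its translate [a] is in block 1. *)
Lemma minimum_period_block (g : R -> nat) : a < p ->
  (forall x, 0 <= x -> g x = block p a x) -> minimum_period g p.
Proof.
move=> ap gE; split.
  exists 0; split=> // x x0.
  by rewrite !gE ?block_period // addr_ge0 // ltW.
move=> q [x0 [q_gt0 x0_ge0 gq]]; rewrite leNgt; apply/negP => qp.
(* a multiple of [p] beyond the preperiod *)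
pose k := Num.floor (x0 / p) + 1.
have kp : x0 <= k%:~R * p by rewrite -ler_pdivrMr // ltW // floorD1_gt.
have gk t : 0 <= t -> g (k%:~R * p + t) = block p a (k%:~R * p + t).
  by move=> t0; rewrite gE // addr_ge0 // (le_trans x0_ge0).
have gkq t : 0 <= t -> g (k%:~R * p + (t + q)) = g (k%:~R * p + t).
  by move=> t0; rewrite addrA gq // ler_wpDr.
have qa : q < a.
  have := gkq 0 (lexx 0); rewrite add0r !gk // ?(ltW q_gt0) // => qE.
  have /eqP z : block p a (k%:~R * p + 0) == 0%N.
    by rewrite block_eq ?lexx ?p_gt0 // mul0r mul1r lexx.
  move/eqP: qE; rewrite z block_eq ?(ltW q_gt0) // mul1r.
  by case/andP.
have aq : 0 <= a - q by rewrite subr_ge0 ltW.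
have := gkq _ aq; rewrite subrK !gk // ?(ltW a_gt0) //.
have /eqP -> : block p a (k%:~R * p + a) == 1%N.
  by rewrite block_eq ?(ltW a_gt0) // mul1r lexx ltr_pMl // ltr1n.
have /eqP -> // : block p a (k%:~R * p + (a - q)) == 0%N.
by rewrite block_eq ?mul0r ?mul1r aq ?gtrBl // (lt_trans _ ap) // gtrBl.
Qed.

End Block.

Section Windows.
Variables (R : realType) (S : {fset R}) (a b : R).
Hypotheses (a_gt0 : 0 < a) (ab : a <= b).
Hypothesis S_itv : forall c, c \in S -> a <= c <= b.
Hypothesis S_window : forall y, a <= y < b + a ->
  exists2 c, c \in S & y - a < c <= y.

Lemma nim_value_block (x : R) : 0 <= x -> nim_value S x = block (b + a) a x.
Proof.
have S_gt0 c : c \in S -> 0 < c.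
  by move=> /S_itv/andP[ac _]; apply: lt_le_trans ac.
have p_gt0 : 0 < b + a by rewrite addr_gt0 // (lt_le_trans a_gt0).
move=> x0; symmetry; apply: (nim_value_uniq S_gt0) x x0 => x x0.
symmetry.
have t_itv := rmod_itv p_gt0 x; have n_itv := block_itv p_gt0 a_gt0 x.
move: (block _ _ x) n_itv => n /andP[nt tn].
pose k := Num.floor (x / (b + a)).
have xE : x = k%:~R * (b + a) + rmod x (b + a) by rewrite /rmod addrC subrK.
move: (rmod x _) t_itv nt tn xE => t /andP[t0 tp] nt tn xE.
apply: mexP => [|m mn].
- apply/mapP => -[_ /mapP[c + ->] nE]; rewrite mem_filter => /andP[cx cS].
  have /andP[ac cb] := S_itv cS.
  move/eqP: nE; rewrite eq_sym; apply/negP; case: (leP c t) => ct.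
  + have -> : x - c = k%:~R * (b + a) + (t - c) by rewrite xE addrA.
    rewrite block_eq //; last by apply/andP; split; lra.
    rewrite negb_and -ltNge; apply/orP; left.
    by move: tn; rewrite -natr1; lra.
  (* [x - c] lies in the previous period, with residue [t + a + (b - c)] *)
  + have -> : x - c = (k - 1)%:~R * (b + a) + (t - c + (b + a)).
      by rewrite {1}xE intrD; lra.
    rewrite block_eq //; last by apply/andP; split; lra.
    rewrite negb_and -leNgt; apply/orP; right.
    by rewrite -natr1; lra.
- have m_ge0 : 0 <= m%:R * a by rewrite mulr_ge0 // ltW.
  have m1n : m.+1%:R * a <= n%:R * a by rewrite ler_pM2r // ler_nat.
  rewrite -natr1 in m1n.
  have [|c cS /andP[c1 c2]] := @S_window (t - m%:R * a).
    by apply/andP; split; lra.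
  have /andP[ac _] := S_itv cS.
  apply/mapP; exists (x - c).
    apply/mapP; exists c => //; rewrite mem_filter cS andbT.
    suff : 0 <= k%:~R * (b + a) by lra.
    by rewrite mulr_ge0 ?(ltW p_gt0) // ler0z floor_ge0 divr_ge0 // ltW.
  have -> : x - c = k%:~R * (b + a) + (t - c) by rewrite {1}xE addrA.
  apply/esym/eqP; rewrite block_eq //; last by apply/andP; split; lra.
  by rewrite -natr1; apply/andP; split; lra.
Qed.

End Windows.

(** The element caught is the largest [s j] at most [y]: if it is not the last
    one, the next one exceeds [y], and it is at most [s j + s 1]. *)
Lemma chain_meets_window (R : realType) (s : nat -> R) (r : nat) (y : R) :
  (1 <= r)%N ->
  (forall j, (1 <= j < r)%N -> s j.+1 <= s j + s 1%N) ->
  s 1%N <= y < s r + s 1%N ->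
  exists2 j, (1 <= j <= r)%N & y - s 1%N < s j <= y.
Proof.
elim: r => // -[_ _ _ /andP[s1y ys]|r IH _ s_step /andP[s1y ys]].
  by exists 1%N; rewrite // s1y ltrBlDr ys.
have [sy|ys'] := leP (s r.+2) y.
  by exists r.+2; rewrite ?leqnn // sy ltrBlDr ys.
have [| |j /andP[j1 jr] jy] := IH isT.
- by move=> j /andP[j1 jr]; apply: s_step; rewrite j1 ltnW.
- by rewrite s1y (lt_le_trans ys') // s_step // leqnn.
- by exists j => //; rewrite j1 leqW.
Qed.

Lemma chain_homo (R : realType) (s : nat -> R) (r i j : nat) :
  (forall j, (1 <= j < r)%N -> s j < s j.+1) ->
  (1 <= i <= j)%N -> (j <= r)%N -> s i <= s j.
Proof.
move=> s_incr /andP[i1 ij] jr.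
elim: j ij jr => [|j IH]; first by rewrite leqn0 => /eqP->.
rewrite leq_eqVlt => /predU1P[-> //|ij] jr.
apply: le_trans (IH ij (ltnW jr)) _.
by rewrite ltW // s_incr // jr (leq_trans i1).
Qed.

Theorem theorem2 (R : realType) (r : nat) (s : nat -> R)
    (hr : (1 <= r)%N)
    (s1_gt0 : 0 < s 1%N)
    (s_incr : forall j, (1 <= j < r)%N -> s j < s j.+1)
    (sr_eq1 : s r = 1)
    (s_step : forall j, (1 <= j < r)%N -> s j.+1 <= s j + s 1%N) :
  let g := nim_value [fset s j | j in iota 1 r]%fset in
  [/\ forall x, 0 <= x ->
        (g x)%:Z = Num.floor (rmod x (1 + s 1%N) / s 1%N),
      purely_periodic g
    & minimum_period g (1 + s 1%N)].
Proof.
move=> g; have s1_le1 : s 1%N <= 1.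
  by rewrite -sr_eq1; apply: chain_homo s_incr _ _.
have p_gt0 : 0 < 1 + s 1%N by rewrite addr_gt0.
have mem_iota1 j : (j \in iota 1 r) = (1 <= j <= r)%N.
  by rewrite mem_iota add1n ltnS.
have gE x : 0 <= x -> g x = block (1 + s 1%N) (s 1%N) x.
  apply: nim_value_block => // [c|y y_itv].
    case/imfsetP => j /=; rewrite mem_iota1 => /andP[j1 jr] ->.
    by rewrite -sr_eq1 !(chain_homo s_incr) ?j1 ?jr ?leqnn.
  have [||j j_itv jy] := @chain_meets_window R s r y hr => //.
    by rewrite sr_eq1.
  by exists (s j) => //; apply/imfsetP; exists j; rewrite //= mem_iota1.
split=> [x x0||].
- by rewrite gE // blockE.
- exists (1 + s 1%N); split=> // x x0.
  by rewrite !gE ?block_period // addr_ge0 // ltW.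
- by apply: minimum_period_block gE; rewrite // ltrDr.
Qed.
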